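(* Let $\mathcal{A} \in \mathbb{C}^{I_1 \times \cdots \times I_M \times J_1 \times \cdots \times J_N}$ with $\mathrm{rshrank}(\mathcal{A})=r=H_1\cdots H_R$, where $H_1,\ldots,H_R$ are positive integers. Then there exist a left invertible tensor $\mathcal{F} \in \mathbb{C}^{I_1 \times \cdots \times I_M \times H_1 \times \cdots \times H_R}$ and a right invertible tensor $\mathcal{G} \in \mathbb{C}^{H_1 \times \cdots \times H_R \times J_1 \times \cdots \times J_N}$ such that $$\mathcal{A} = \mathcal{F} *_R \mathcal{G},$$ with $\mathrm{rshrank}(\mathcal{F}) =\mathrm{rshrank}(\mathcal{G})= \mathrm{rshrank}(\mathcal{A}) = r = H_1 \cdots H_R$.
   Context: Einstein product: for $\mathcal{A}\in\mathbb{C}^{I_1\times\cdots\times I_M\times J_1\times\cdots\times J_N}$ and $\mathcal{B}\in\mathbb{C}^{J_1\times\cdots\times J_N\times K_1\times\cdots\times K_L}$, $(\mathcal{A}*_N\mathcal{B})_{i_1\ldots i_Mk_1\ldots k_L}=\sum_{j_1,\ldots,j_N}a_{i_1\ldots i_Mj_1\ldots j_N}b_{j_1\ldots j_Nk_1\ldots k_L}$ (the subscript is the number of contracted indices; similarly $*_R$, $*_M$). $\mathcal{I}_R$ is the identity tensor of $\mathbb{C}^{H_1\times\cdots\times H_R\times H_1\times\cdots\times H_R}$ (entries: products of Kronecker deltas). $\mathcal{F}$ is left invertible if there is a tensor $\mathcal{Z}$ with $\mathcal{Z}*_M\mathcal{F}=\mathcal{I}_R$; $\mathcal{G}$ is right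 invertible if there is a tensor $\mathcal{Z}$ with $\mathcal{G}*_N\mathcal{Z}=\mathcal{I}_R$. The reshape map $\mathrm{rsh}$ sends $\mathcal{A}\in\mathbb{C}^{I_1\times\cdots\times I_M\times J_1\times\cdots\times J_N}$ to the $(I_1\cdots I_M)\times(J_1\cdots J_N)$ matrix whose entry in row $i_1+\sum_{k=2}^{M}(i_k-1)\prod_{l=1}^{k-1}I_l$ and column $j_1+\sum_{k=2}^{N}(j_k-1)\prod_{l=1}^{k-1}J_l$ is $a_{i_1\ldots i_Mj_1\ldots j_N}$ (similarly for $\mathcal{F},\mathcal{G}$), and $\mathrm{rshrank}(\mathcal{A})=\mathrm{rank}(\mathrm{rsh}(\mathcal{A}))$. Such a factorization is called a full rank decomposition of $\mathcal{A}$. *)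

(* Defs.v *)
From mathcomp Require Export all_boot all_algebra reals complex.

Set Implicit Arguments.
Unset Strict Implicit.
Unset Printing Implicit Defensive.

Import GRing.Theory.
Local Open Scope ring_scope.

(* Multi-indices (i_1, ..., i_M) for the dimensions I_1, ..., I_M.  Everything
   is counted from 0. *)
Notation mindex I := {dffun forall k, 'I_(I k)}.

(* tensor C I J is C^(I_1 x ... x I_M x J_1 x ... x J_N); the split of the M + N
   indices into two groups, on which the Einstein product and the reshape map
   depend, is recorded in the type. *)
Definition tensor (C : Type) M N (I : 'I_M -> nat) (J : 'I_N -> nat) : Type :=
  {ffun mindex I * mindex J -> C}.

Definition einstein (C : pzRingType) M N L
    (I : 'I_M -> nat) (J : 'I_N -> nat) (K : 'I_L -> nat)
    (A : tensor C I J) (B : tensor C J K) : tensor C I K :=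
  [ffun ik : mindex I * mindex K => \sum_(j : mindex J) A (ik.1, j) * B (j, ik.2)].

Definition id_tensor (C : pzRingType) M (H : 'I_M -> nat) : tensor C H H :=
  [ffun hh : mindex H * mindex H => \prod_(k < M) (hh.1 k == hh.2 k)%:R].

Definition left_invertible (C : pzRingType) M L
    (I : 'I_M -> nat) (H : 'I_L -> nat) (F : tensor C I H) : Prop :=
  exists Z : tensor C H I, einstein Z F = id_tensor C H.

Definition right_invertible (C : pzRingType) L N
    (H : 'I_L -> nat) (J : 'I_N -> nat) (G : tensor C H J) : Prop :=
  exists Z : tensor C J H, einstein G Z = id_tensor C H.

Section Position.
Variables (M : nat) (I : 'I_M -> nat).

Definition weight (k : nat) : nat := (\prod_(l < M | (l < k)%N) I l)%N.

(* With 1-based i_k this is  i_1 + \sum_(k >= 2) (i_k - 1) \prod_(l < k) I_l,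
   minus 1. *)
Definition rsh_pos_nat (i : mindex I) : nat := (\sum_(k < M) i k * weight k)%N.

Let low (i : mindex I) (m : nat) : nat :=
  (\sum_(k < M | (k < m)%N) i k * weight k)%N.

Lemma weightS (k : 'I_M) : weight k.+1 = (I k * weight k)%N.
Proof.
rewrite /weight (bigD1 k) //=; congr (_ * _)%N; apply: eq_bigl => l.
by rewrite ltnS leq_eqVlt -val_eqE /=; case: ltngtP.
Qed.

Lemma weight_all : weight M = (\prod_(k < M) I k)%N.
Proof. by apply: eq_bigl => l; rewrite ltn_ord. Qed.

Lemma lowS (i : mindex I) (k : 'I_M) :
  low i k.+1 = (i k * weight k + low i k)%N.
Proof.
rewrite /low (bigD1 k) //=; congr (_ + _)%N; apply: eq_bigl => l.
by rewrite ltnS leq_eqVlt -val_eqE /=; case: ltngtP.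
Qed.

Lemma low_ub (i : mindex I) m : (m <= M)%N -> (low i m < weight m)%N.
Proof.
elim: m => [|m IHm] lt_mM; first by rewrite /low /weight !big_pred0.
pose k := Ordinal lt_mM; rewrite -[m]/(k : nat) lowS weightS.
apply: (@leq_trans (i k * weight k + weight k)); last first.
  by rewrite -mulSnr leq_mul2r ltn_ord orbT.
by rewrite -addnS leq_add2l; apply: IHm; apply: ltnW.
Qed.

Lemma rsh_pos_subproof (i : mindex I) :
  (rsh_pos_nat i < \prod_(k < M) I k)%N.
Proof.
rewrite -weight_all; have := low_ub i (leqnn M).
by rewrite /low /rsh_pos_nat; under eq_bigl do rewrite ltn_ord.
Qed.

Definition rsh_pos (i : mindex I) : 'I_(\prod_(k < M) I k)%N :=
  Ordinal (rsh_pos_subproof i).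

Lemma rsh_digit_subproof (p : 'I_(\prod_(k < M) I k)%N) (k : 'I_M) :
  (p %/ weight k %% I k < I k)%N.
Proof.
apply: ltn_pmod; case: (posnP (I k)) p => // Ik0 [p].
by rewrite (bigD1 k) //= Ik0 mul0n.
Qed.

Definition rsh_index (p : 'I_(\prod_(k < M) I k)%N) : mindex I :=
  [ffun k => Ordinal (rsh_digit_subproof p k)].

Lemma rsh_posK : cancel rsh_pos rsh_index.
Proof.
move=> i; apply/ffunP => k; rewrite ffunE; apply: val_inj => /=.
have Hk := low_ub i (ltnW (ltn_ord k)).
have w0 : (0 < weight k)%N by apply: leq_ltn_trans Hk.
have [X ->] : exists X, rsh_pos_nat i = (low i k.+1 + X * weight k.+1)%N.
  have dvd : (weight k.+1 %| \sum_(l < M | ~~ (l < k.+1)) i l * weight l)%N.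
    apply: (big_ind (fun x => weight k.+1 %| x)%N) => [|x y|l];
      [exact: dvdn0 | exact: dvdn_add | ].
    rewrite -leqNgt => lt_kl; apply: dvdn_mull.
    rewrite {2}/weight (bigID (fun j : 'I_M => (j < k.+1)%N)) /=.
    rewrite [X in (_ %| X * _)%N](_ : _ = weight k.+1) ?dvdn_mulr //.
    apply: eq_bigl => j; case: (ltnP j k.+1) => [ltj|]; last by rewrite andbF.
    by rewrite andbT; apply: leq_trans lt_kl.
  exists ((\sum_(l < M | ~~ (l < k.+1)) i l * weight l) %/ weight k.+1)%N.
  rewrite divnK // /rsh_pos_nat /low.
  by rewrite (bigID (fun j : 'I_M => (j < k.+1)%N)).
rewrite lowS weightS mulnA addnAC -mulnDl divnMDl // divn_small // addn0.
by rewrite addnC modnMDl modn_small.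
Qed.

Lemma rsh_indexK : cancel rsh_index rsh_pos.
Proof.
have inj := can_inj rsh_posK.
suff /(inj_card_bij inj) [g gK Kg] :
    (#|'I_(\prod_(k < M) I k)%N| <= #|{: mindex I}|)%N.
  by move=> p; rewrite -[p]Kg rsh_posK.
by rewrite card_dep_ffun card_ord foldrE big_map big_enum /=;
   under [X in (_ <= X)%N]eq_bigr do rewrite card_ord.
Qed.

End Position.

(* The entry in row rsh_pos i and column rsh_pos j is A (i, j): see rshE. *)
Definition rsh (C : Type) M N (I : 'I_M -> nat) (J : 'I_N -> nat)
    (A : tensor C I J) : 'M[C]_((\prod_(k < M) I k)%N, (\prod_(k < N) J k)%N) :=
  \matrix_(p, q) A (rsh_index p, rsh_index q).

Lemma rshE (C : Type) M N (I : 'I_M -> nat) (J : 'I_N -> nat)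
    (A : tensor C I J) (i : mindex I) (j : mindex J) :
  rsh A (rsh_pos i) (rsh_pos j) = A (i, j).
Proof. by rewrite mxE !rsh_posK. Qed.

Definition rshrank (C : fieldType) M N (I : 'I_M -> nat) (J : 'I_N -> nat)
    (A : tensor C I J) : nat := \rank (rsh A).

(* Main.v *)
Require Import Defs.
Local Open Scope ring_scope.
Local Open Scope complex_scope.

(* [rsh] is a bijection that turns the Einstein product into the matrix product
   and the identity tensor into the identity matrix, so the theorem is the
   full rank factorization of the matrix [rsh A]. *)

Definition unrsh {C : Type} {M N} {I : 'I_M -> nat} {J : 'I_N -> nat}
    (B : 'M[C]_((\prod_(k < M) I k)%N, (\prod_(k < N) J k)%N)) : tensor C I J :=
  [ffun ij : mindex I * mindex J => B (rsh_pos ij.1) (rsh_pos ij.2)].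

Lemma unrshK (C : Type) M N (I : 'I_M -> nat) (J : 'I_N -> nat) :
  cancel (@unrsh C M N I J) (@rsh C M N I J).
Proof. by move=> B; apply/matrixP => p q; rewrite mxE ffunE /= !rsh_indexK. Qed.

Lemma rsh_inj (C : Type) M N (I : 'I_M -> nat) (J : 'I_N -> nat) :
  injective (@rsh C M N I J).
Proof. by move=> A B eqAB; apply/ffunP => -[i j]; rewrite -!rshE eqAB. Qed.

(** The bijection [rsh_index] reindexes the sum over contracted multi-indices as a sum over matrix
    positions. *)
Lemma rsh_einstein (C : pzRingType) M N L
    (I : 'I_M -> nat) (J : 'I_N -> nat) (K : 'I_L -> nat)
    (A : tensor C I J) (B : tensor C J K) :
  rsh (einstein A B) = rsh A *m rsh B.
Proof.
apply/matrixP => p q; rewrite !mxE ffunE /=.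
rewrite (reindex (@rsh_index N J)) /=; last first.
  exact: onW_bij (Bijective (@rsh_indexK N J) (@rsh_posK N J)).
by apply: eq_bigr => s _; rewrite !mxE.
Qed.

Lemma rsh_id_tensor (C : pzRingType) M (H : 'I_M -> nat) :
  rsh (id_tensor C H) = 1%:M.
Proof.
apply/matrixP => p q; rewrite !mxE ffunE /=.
have [->|neq_pq] := eqVneq p q; first by rewrite big1 // => k _; rewrite eqxx.
(* As [rsh_index] is injective, distinct positions differ in some digit [k], and the Kronecker delta
   at [k] kills the product. *)
have [k neq_k] : exists k, rsh_index p k != rsh_index q k.
  apply/existsP; rewrite -negb_forall; apply: contra neq_pq => /forallP eq_pq.
  apply/eqP/(can_inj (@rsh_indexK M H))/ffunP => k; exact/eqP.
by rewrite -GRing.natr_prod (bigD1 k) //= (negbTE neq_k) mul0n.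
Qed.

(** The columns of [F] are a basis of the column space of [A], the rows of [G] one of its row space.
    The inner size is a variable [s], not [\rank A], so that it can be the product of the [H k], as
    [unrsh] requires. *)
Lemma full_rank_factorization (K : fieldType) m n s (A : 'M[K]_(m, n)) :
  \rank A = s ->
  exists (F : 'M[K]_(m, s)) (G : 'M[K]_(s, n)),
    [/\ row_full F, row_free G & A = F *m G].
Proof.
move=> <-; exists (col_base A), (row_base A).
by rewrite col_base_full row_base_free mulmx_base.
Qed.

Theorem theorem9 (Re : realType) (M N R : nat)
    (I : 'I_M -> nat) (J : 'I_N -> nat) (H : 'I_R -> nat)
    (A : tensor Re[i] I J) (r : nat)
    (H_gt0 : forall k : 'I_R, (0 < H k)%N)
    (rankA : rshrank A = r) (rH : r = (\prod_(k < R) H k)%N) :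
  exists (F : tensor Re[i] I H) (G : tensor Re[i] H J),
    [/\ left_invertible F,
        right_invertible G,
        A = einstein F G
      & [/\ rshrank F = r, rshrank G = r, rshrank A = r
          & r = (\prod_(k < R) H k)%N]].
Proof.
have [F [G [fullF freeG defA]]] := full_rank_factorization _ _ _ _ _ (etrans rankA rH).
exists (unrsh F), (unrsh G); split.
(* Full column rank gives a left inverse matrix of [F], which reshapes to a left inverse tensor;
   dually for [G] below. *)
- have [Z ZF] := row_fullP fullF; exists (unrsh Z).
  by apply: rsh_inj; rewrite rsh_einstein !unrshK rsh_id_tensor.
- have [Z GZ] := row_freeP freeG; exists (unrsh Z).
  by apply: rsh_inj; rewrite rsh_einstein !unrshK rsh_id_tensor.
- by apply: rsh_inj; rewrite rsh_einstein !unrshK.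
(* By definition, [fullF] and [freeG] state that [F] and [G] have rank equal to the product of the
   [H k]. *)
split=> //; rewrite /rshrank unrshK rH; exact/eqP.
Qed.
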